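(* Let $a\in\mathbb{C}$ with $|a|<1$. For every $f\in C(\mathbb{T})$ and every $n=0,1,2,\dots$, $$\|S_n^a(f)\|_\infty\le \Lambda_n\,\|f\|_\infty .$$
   Context: $\mathbb{T}=\mathbb{R}/2\pi\mathbb{Z}$; functions on $\mathbb{T}$ are real- or complex-valued and identified with $2\pi$-periodic functions on $\mathbb{R}$; $C(\mathbb{T})$ is the space of continuous ones and $\|\cdot\|_\infty$ the (essential) supremum norm. For $a=|a|e^{it_a}$, $|a|<1$, the nonlinear phase function $\theta_a:\mathbb{R}\to\mathbb{R}$ is the continuous function with $e^{i\theta_a(t)}=\dfrac{e^{it}-a}{1-\overline{a}e^{it}}$ (a fixed choice of continuous branch). It is strictly increasing, satisfies $\theta_a(t+2\pi)=\theta_a(t)+2\pi$, and has derivative the Poisson kernel $\theta_a'(t)=p_a(t)=\dfrac{1-|a|^2}{1-2|a|\cos(t-t_a)+|a|^2}$. For $f\in L^1(\mathbb{T})$, $c_k(f)=\dfrac1{2\pi}\displaystyle\int_{-\pi}^{\pi}f(t)e^{-ik\theta_a(t)}p_a(t)\,dt$ for $k\in\mathbb{Z}$, and $S_n^a(f)(x)=\displaystyle\sum_{k=-n}^{n}c_k(f)e^{ik\theta_a(x)}$ is the $n$-th partial sum of the nonlinear Fourier series of $f$. $\Lambda_n=\dfrac1{2\pi}\displaystyle\int_{-\pi}^{\pi}|D_n(t)|\,dt$ is the Lebesgue constant, where $D_n(t)=\sum_{k=-n}^{n}e^{ikt}$ is the Dirichlet kernel. *)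

(* Defs.v *)
From Stdlib Require Import Reals ZArith.
From Coquelicot Require Import Coquelicot.

Open Scope R_scope.

(* [cis t] is exp(i t). *)
Definition cis (t : R) : C := (cos t, sin t).

(* Sum of [F k] over the integers -n <= k <= n, enumerated as k = j - n with
   0 <= j <= 2 n. *)
Definition sum_sym (n : nat) (F : Z -> C) : C :=
  sum_n (fun j : nat => F (Z.of_nat j - Z.of_nat n)%Z) (2 * n).

(* C(T) for T = R / 2 pi Z, identified with the continuous 2 pi-periodic
   functions on R.  Real-valued functions are included through the embedding
   of R in C. *)
Definition continuous_on_circle (f : R -> C) : Prop :=
  (forall t : R, continuous f t) /\ (forall t : R, f (t + 2 * PI) = f t).

(* Supremum norm, with values in the extended reals so that it is the genuine
   supremum for every function. *)
Definition sup_norm (f : R -> C) : Rbar :=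
  Lub_Rbar (fun y : R => exists x : R, y = Cmod (f x)).

(* The branch of the phase is arbitrary: any continuous [theta] that satisfies
   the defining equation is admitted. *)
Definition is_nonlinear_phase (a : C) (theta : R -> R) : Prop :=
  (forall t : R, continuous theta t) /\
  (forall t : R,
     cis (theta t) = ((cis t - a) / (RtoC 1 - Cconj a * cis t))%C).

(* Poisson kernel; [ta] is an argument of [a], i.e. a = |a| exp(i ta). *)
Definition poisson (a : C) (ta t : R) : R :=
  (1 - Cmod a ^ 2) / (1 - 2 * Cmod a * cos (t - ta) + Cmod a ^ 2).

(* The integral is the Riemann integral of a C-valued function, C being regarded
   as a real vector space; for continuous [f] and [theta] the integrand is
   continuous and this is the Lebesgue integral. *)
Definition nl_coef (a : C) (ta : R) (theta : R -> R) (f : R -> C) (k : Z) : C :=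
  (RtoC (/ (2 * PI)) *
   RInt (V := C_R_CompleteNormedModule)
     (fun t : R => f t * cis (- (IZR k * theta t)) * RtoC (poisson a ta t))%C
     (- PI) PI)%C.

Definition nl_partial_sum (a : C) (ta : R) (theta : R -> R) (n : nat)
    (f : R -> C) (x : R) : C :=
  sum_sym n (fun k : Z => nl_coef a ta theta f k * cis (IZR k * theta x))%C.

Definition dirichlet (n : nat) (t : R) : C :=
  sum_sym n (fun k : Z => cis (IZR k * t)).

Definition lebesgue_constant (n : nat) : R :=
  / (2 * PI) * RInt (fun t : R => Cmod (dirichlet n t)) (- PI) PI.

(* Main.v *)
Require Import Defs.
From Stdlib Require Import Reals ZArith Lra Lia.
From Coquelicot Require Import Coquelicot.

Open Scope R_scope.

(** The change of variable s = theta(t) turns the nonlinear Fourier series into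
    the classical one.  Summing the coefficients under the integral sign gives

      S_n(f)(x) = 1/(2 pi) int_{-pi}^{pi} f(t) D_n(theta(x) - theta(t)) p(t) dt,

    and since p >= 0 the modulus is at most sup |f| times

      1/(2 pi) int_{-pi}^{pi} |D_n(theta(x) - theta(t))| p(t) dt.

    As p = theta' and theta increases by exactly 2 pi over a period, the last
    expression is the mean of |D_n| over an interval of length 2 pi, that is, the
    Lebesgue constant, whatever x is.

    The abstract branch theta enters the partial sums only through the integral
    powers of exp(i theta), so theta can be replaced by the explicit
    branch [phase], for which exp(i phase) is the Blaschke factor ([cis_phase]), the derivative is the Poisson kernel ([is_derive_phase]) and
    the increment over a period is 2 pi ([phase_2PI]).  The integral
    formula is [is_RInt_nl_partial_sum], the change of variable is
    [is_RInt_dirichlet_phase], and [Cmod_nl_partial_sum_le] combines them.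
    Finally, f is bounded ([continuous_on_circle_bounded]), so sup |f| is an
    actual real bound to which this estimate applies. *)

(** * The function exp(i t) *)

Lemma cis_plus (s t : R) : cis (s + t) = (cis s * cis t)%C.
Proof.
  unfold cis, Cmult; simpl; rewrite cos_plus, sin_plus; f_equal; ring.
Qed.

Lemma cis_opp (t : R) : cis (- t) = Cconj (cis t).
Proof. unfold cis, Cconj; simpl; now rewrite cos_neg, sin_neg. Qed.

Lemma cis_2PI (t : R) : cis (t + 2 * PI) = cis t.
Proof.
  unfold cis; rewrite cos_plus, sin_plus, cos_2PI, sin_2PI; f_equal; ring.
Qed.

(** Integral powers of exp(i t) do not depend on the choice of the argument t;
    this is what makes the branch of the phase irrelevant. *)
Lemma cis_IZR_mult_ext (k : Z) (s t : R) :
  cis s = cis t -> cis (IZR k * s) = cis (IZR k * t).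
Proof.
  intros Hst.
  assert (Hnat : forall m : nat, cis (INR m * s) = cis (INR m * t)).
  { induction m as [|m IH].
    - now rewrite !Rmult_0_l.
    - now rewrite S_INR, !Rmult_plus_distr_r, !Rmult_1_l, !cis_plus, IH, Hst. }
  destruct (Z_le_gt_dec 0 k) as [Hk|Hk].
  - rewrite <- (Z2Nat.id k Hk), <- INR_IZR_INZ; apply Hnat.
  - replace k with (- Z.of_nat (Z.to_nat (- k)))%Z by (rewrite Z2Nat.id; lia).
    rewrite opp_IZR, <- INR_IZR_INZ, <- !Ropp_mult_distr_l, !cis_opp.
    now rewrite Hnat.
Qed.

(** * An explicit phase and the Poisson kernel *)

(** With a = r exp(i ta), u = t - ta and z = 1 - r exp(i u), the Blaschke factor is
    exp(i t) (conj z / z).  As Re z > 0, the argument of conj z is the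
    arctangent below, and conj z / z has twice that argument. *)
Definition phase (r ta t : R) : R :=
  t + 2 * atan (r * sin (t - ta) / (1 - r * cos (t - ta))).

Lemma one_minus_rcos_pos (r u : R) : 0 <= r < 1 -> 0 < 1 - r * cos u.
Proof. intros Hr; pose proof (COS_bound u); nra. Qed.

Lemma poisson_denom_pos (r u : R) : 0 <= r < 1 -> 0 < 1 - 2 * r * cos u + r ^ 2.
Proof. intros Hr; pose proof (COS_bound u); nra. Qed.

(** The rational parametrization of the circle: exp(2 i atan x) =
    (1 + i x) / (1 - i x). *)
Lemma cis_2atan (x : R) :
  cis (2 * atan x) = ((1 - x ^ 2) / (1 + x ^ 2), 2 * x / (1 + x ^ 2)).
Proof.
  assert (Hx : 0 < 1 + x ^ 2) by nra.
  unfold cis; rewrite cos_2a, sin_2a, cos_atan, sin_atan.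
  assert (Hs : sqrt (1 + Rsqr x) * sqrt (1 + Rsqr x) = 1 + x ^ 2)
    by (rewrite sqrt_sqrt; unfold Rsqr; nra).
  assert (Hs0 : sqrt (1 + Rsqr x) <> 0)
    by (intros H0; rewrite H0 in Hs; lra).
  f_equal; rewrite <- Hs; [|field; assumption].
  replace (x ^ 2) with (sqrt (1 + Rsqr x) * sqrt (1 + Rsqr x) - 1) by lra.
  replace (x / sqrt (1 + Rsqr x) * (x / sqrt (1 + Rsqr x)))
    with (x ^ 2 / (sqrt (1 + Rsqr x) * sqrt (1 + Rsqr x))) by (field; assumption).
  replace (x ^ 2) with (sqrt (1 + Rsqr x) * sqrt (1 + Rsqr x) - 1) by lra.
  field; assumption.
Qed.

Lemma cis_phase (r ta t : R) : 0 <= r < 1 ->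
  cis (phase r ta t) =
  ((cis t - RtoC r * cis ta) / (RtoC 1 - Cconj (RtoC r * cis ta) * cis t))%C.
Proof.
  intros Hr.
  unfold phase; rewrite cis_plus, cis_2atan.
  set (u := t - ta).
  assert (Hu : ta = t - u) by (unfold u; ring).
  clearbody u; subst ta.
  pose proof (one_minus_rcos_pos r u Hr) as Hd.
  pose proof (poisson_denom_pos r u Hr) as Hp.
  pose proof (sin2_cos2 u) as Hu; unfold Rsqr in Hu.
  pose proof (sin2_cos2 t) as Ht; unfold Rsqr in Ht.
  (* Numerator and denominator become exp(i t) conj z and z, where
     z = 1 - r exp(i u). *)
  assert (Hz : (RtoC 1 - Cconj (RtoC r * cis (t - u)) * cis t)%C
               = (1 - r * cos u, - (r * sin u))).
  { unfold cis, Cconj, Cminus, Cplus, Copp, Cmult, RtoC; simpl.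
    rewrite cos_minus, sin_minus; f_equal.
    - transitivity (1 - r * cos u * (sin t * sin t + cos t * cos t));
        [ring | rewrite Ht; ring].
    - transitivity (- (r * sin u) * (sin t * sin t + cos t * cos t));
        [ring | rewrite Ht; ring]. }
  assert (Hw : (cis t - RtoC r * cis (t - u))%C
               = (cis t * ((1 - r * cos u)%R, (r * sin u)%R))%C).
  { unfold cis, Cminus, Cplus, Copp, Cmult, RtoC; simpl.
    rewrite cos_minus, sin_minus; f_equal; ring. }
  rewrite Hz, Hw; clear Hz Hw.
  unfold Cdiv; rewrite <- Cmult_assoc; f_equal.
  unfold Cinv, Cmult; simpl.
  assert (Hn : (1 - r * cos u) * (1 - r * cos u) + r * sin u * (r * sin u) <> 0) by nra.
  f_equal; field; repeat split; try lra; try (intros H0; apply Hn; lra).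
Qed.

Lemma is_derive_phase (a : C) (ta t : R) : Cmod a < 1 ->
  is_derive (phase (Cmod a) ta) t (poisson a ta t).
Proof.
  intros Ha; unfold phase, poisson.
  set (r := Cmod a).
  assert (Hr : 0 <= r < 1) by (split; [apply Cmod_ge_0 | exact Ha]).
  clearbody r.
  pose proof (one_minus_rcos_pos r (t - ta) Hr) as Hd.
  pose proof (poisson_denom_pos r (t - ta) Hr) as Hp.
  pose proof (sin2_cos2 (t - ta)) as Hs; unfold Rsqr in Hs.
  auto_derive; unfold Rminus in *.
  - lra.
  - set (c := cos _) in *; set (s := sin _) in *; clearbody c s.
    simpl in *.
    (* Both sides are |1 - r exp(i u)|^2: this relates the denominator produced
       by the arctangent to that of the Poisson kernel. *)
    assert (Hn : (1 + - (r * c)) * (1 + - (r * c)) + r * s * (r * s) 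
       = 1 + - (2 * r * c) + r * (r * 1)) by nra.
    replace (2 * r * c) with (2 * (r * c)) in * by ring.
    field_simplify_eq.
    + replace (s ^ 2) with (1 - c ^ 2) by (simpl; lra); ring.
    + repeat split; nra.
Qed.

Lemma continuous_poisson (a : C) (ta t : R) : Cmod a < 1 ->
  continuous (poisson a ta) t.
Proof.
  intros Ha.
  apply (ex_derive_continuous (poisson a ta)).
  pose proof (poisson_denom_pos (Cmod a) (t - ta) (conj (Cmod_ge_0 a) Ha)) as Hp.
  unfold poisson; auto_derive; unfold Rminus in *; simpl in *; lra.
Qed.

Lemma poisson_ge_0 (a : C) (ta t : R) : Cmod a < 1 -> 0 <= poisson a ta t.
Proof.
  intros Ha; unfold poisson.
  pose proof (Cmod_ge_0 a).
  apply Rdiv_le_0_compat; [nra | now apply poisson_denom_pos].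
Qed.

(** The arctangent term is periodic, so the winding number is that of the
    summand t. *)
Lemma phase_2PI (r ta t : R) : phase r ta (t + 2 * PI) = phase r ta t + 2 * PI.
Proof.
  unfold phase.
  replace (t + 2 * PI - ta) with (t - ta + 2 * PI) by ring.
  pose proof (cis_2PI (t - ta)) as H; injection H as Hc Hs.
  rewrite Hc, Hs; ring.
Qed.

(** * Continuity and integration of complex-valued functions *)

(** Continuity is handled componentwise because C carries the product topology of
    R * R here, whereas the generic product rule [continuous_mult] on C speaks of
    the topology given by the modulus. *)
Lemma continuous_C (g : R -> C) (t : R) :
  continuous (fun s => fst (g s)) t -> continuous (fun s => snd (g s)) t ->
  continuous g t.
Proof.
  intros H1 H2.
  apply (continuous_ext (fun s => (fst (g s), snd (g s)))).
  - intros s; now destruct (g s).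
  - now apply (continuous_comp_2 _ _ (fun x y : R => (x, y)) t H1 H2),
      (continuous_ext (fun z => z)); [intros [] | apply continuous_id].
Qed.

Lemma continuous_Re (g : R -> C) (t : R) :
  continuous g t -> continuous (fun s => fst (g s)) t.
Proof.
  intros H; apply (continuous_comp g fst t H).
  destruct (g t); apply continuous_fst.
Qed.

Lemma continuous_Im (g : R -> C) (t : R) :
  continuous g t -> continuous (fun s => snd (g s)) t.
Proof.
  intros H; apply (continuous_comp g snd t H).
  destruct (g t); apply continuous_snd.
Qed.

Lemma continuous_RtoC (g : R -> R) (t : R) :
  continuous g t -> continuous (fun s => RtoC (g s)) t.
Proof. intros H; apply continuous_C; [exact H | apply continuous_const]. Qed.

Lemma continuous_Cmult (g h : R -> C) (t : R) :
  continuous g t -> continuous h t -> continuous (fun s => g s * h s)%C t.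
Proof.
  intros Hg Hh.
  pose proof (continuous_Re g t Hg); pose proof (continuous_Im g t Hg).
  pose proof (continuous_Re h t Hh); pose proof (continuous_Im h t Hh).
  apply continuous_C; simpl.
  - apply (continuous_minus (V := R_NormedModule));
      now apply (continuous_mult (K := R_AbsRing)).
  - apply (continuous_plus (V := R_NormedModule));
      now apply (continuous_mult (K := R_AbsRing)).
Qed.

Lemma continuous_cis (g : R -> R) (t : R) :
  continuous g t -> continuous (fun s => cis (g s)) t.
Proof.
  intros H; apply continuous_C; simpl.
  - now apply (continuous_comp g cos), continuous_cos.
  - now apply (continuous_comp g sin), continuous_sin.
Qed.

Lemma norm_C_R (z : C) : norm (V := C_R_NormedModule) z = Cmod z.
Proof.
  destruct z as [x y]; unfold norm, Cmod; simpl; unfold prod_norm; simpl.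
  unfold norm; simpl; unfold abs; simpl.
  f_equal; rewrite !Rmult_1_r; f_equal; rewrite <- Rabs_mult; apply Rabs_pos_eq; nra.
Qed.

Lemma continuous_Cmod (g : R -> C) (t : R) :
  continuous g t -> continuous (fun s => Cmod (g s)) t.
Proof.
  intros H.
  apply (continuous_ext (fun s => norm (V := C_R_NormedModule) (g s))).
  - intros s; apply norm_C_R.
  - apply (continuous_comp g (norm (V := C_R_NormedModule))); [exact H|].
    apply (filterlim_norm (V := C_R_NormedModule)).
Qed.

(** C is a normed module over R here, so the linearity of the integral
    covers only real scalars; a complex one mixes the two components. *)
Lemma is_RInt_Cmult_l (c : C) (g : R -> C) (a b : R) (l : C) :
  is_RInt (V := C_R_NormedModule) g a b l ->
  is_RInt (V := C_R_NormedModule) (fun t => c * g t)%C a b (c * l)%C.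
Proof.
  intros H.
  pose proof (is_RInt_fct_extend_fst g a b l H) as H1.
  pose proof (is_RInt_fct_extend_snd g a b l H) as H2.
  apply (is_RInt_fct_extend_pair (U := R_NormedModule) (V := R_NormedModule)); simpl.
  - apply (is_RInt_minus (V := R_NormedModule));
      now apply (is_RInt_scal (V := R_NormedModule)).
  - apply (is_RInt_plus (V := R_NormedModule));
      now apply (is_RInt_scal (V := R_NormedModule)).
Qed.

Lemma is_RInt_sum_n {V : NormedModule R_AbsRing} (F : nat -> R -> V) (I : nat -> V)
    (a b : R) (n : nat) :
  (forall j, is_RInt (F j) a b (I j)) ->
  is_RInt (fun t => sum_n (fun j => F j t) n) a b (sum_n I n).
Proof.
  intros H; induction n as [|n IH].
  - rewrite sum_O; apply (is_RInt_ext (F 0%nat)); [|apply H].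
    intros t _; now rewrite sum_O.
  - rewrite sum_Sn.
    apply (is_RInt_ext (fun t => plus (sum_n (fun j => F j t) n) (F (S n) t))).
    + intros t _; now rewrite sum_Sn.
    + now apply is_RInt_plus.
Qed.

Lemma continuous_sum_n {U : UniformSpace} {V : NormedModule R_AbsRing}
    (F : nat -> U -> V) (x : U) (n : nat) :
  (forall j, continuous (F j) x) ->
  continuous (fun t => sum_n (fun j => F j t) n) x.
Proof.
  intros H; induction n as [|n IH].
  - apply (continuous_ext (F 0%nat)); [|apply H].
    intros t; now rewrite sum_O.
  - apply (continuous_ext (fun t => plus (sum_n (fun j => F j t) n) (F (S n) t))).
    + intros t; now rewrite sum_Sn.
    + now apply continuous_plus.
Qed.

Lemma continuous_dirichlet (n : nat) (t : R) : continuous (dirichlet n) t.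
Proof.
  apply (continuous_sum_n (V := C_R_NormedModule)
           (fun j s => cis (IZR (Z.of_nat j - Z.of_nat n) * s))).
  intros j; apply continuous_cis.
  apply (continuous_mult (K := R_AbsRing)); [apply continuous_const | apply continuous_id].
Qed.

Lemma dirichlet_2PI (n : nat) (t : R) : dirichlet n (t + 2 * PI) = dirichlet n t.
Proof.
  apply sum_n_ext; intros j; apply cis_IZR_mult_ext, cis_2PI.
Qed.

(** Splitting [a, b + T] at a + T or at b, the two end pieces have equal integrals
    by translation. *)
Lemma RInt_period (g : R -> R) (T a b : R) :
  (forall t, continuous g t) -> (forall t, g (t + T) = g t) ->
  RInt g a (a + T) = RInt g b (b + T).
Proof.
  intros Hc HT.
  assert (Hex : forall u v, ex_RInt g u v)
    by (intros u v; apply (ex_RInt_continuous (V := R_CompleteNormedModule)); intros; apply Hc).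
  assert (Hshift : RInt g (a + T) (b + T) = RInt g a b).
  { pose proof (RInt_comp_lin g 1 T a b (Hex _ _)) as H.
    rewrite !Rmult_1_l in H; rewrite <- H.
    apply RInt_ext; intros t _.
    rewrite Rmult_1_l; unfold scal; simpl; unfold mult; simpl.
    rewrite Rmult_1_l; apply HT. }
  pose proof (RInt_Chasles g a (a + T) (b + T) (Hex _ _) (Hex _ _)) as H1.
  pose proof (RInt_Chasles g a b (b + T) (Hex _ _) (Hex _ _)) as H2.
  unfold plus in H1, H2; simpl in H1, H2; lra.
Qed.

(** * The integral formula and the bound *)

Lemma sum_sym_mult_r (n : nat) (F : Z -> C) (c : C) :
  (sum_sym n F * c)%C = sum_sym n (fun k => F k * c)%C.
Proof.
  unfold sum_sym; induction (2 * n)%nat as [|m IH].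
  - now rewrite !sum_O.
  - rewrite !sum_Sn, <- IH; apply Cmult_plus_distr_r.
Qed.

(** The factor cis (k theta(x)) of the k-th term moves inside the integral defining
    the coefficient; the sum over k of cis (k (theta(x) - theta(t))) is then the
    Dirichlet kernel. *)
Lemma is_RInt_nl_partial_sum (a : C) (ta : R) (theta : R -> R) (f : R -> C)
    (n : nat) (x : R) :
  Cmod a < 1 -> (forall t, cis (theta t) = cis (phase (Cmod a) ta t)) ->
  (forall t, continuous f t) ->
  is_RInt (V := C_R_NormedModule)
    (fun t => dirichlet n (phase (Cmod a) ta x - phase (Cmod a) ta t)
              * (RtoC (/ (2 * PI)) * (f t * RtoC (poisson a ta t))))%C
    (- PI) PI (nl_partial_sum a ta theta n f x).
Proof.
  intros Ha Hth Hf.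
  set (P := phase (Cmod a) ta).
  set (F := fun (k : Z) (t : R) =>
    ((RtoC (/ (2 * PI)) * cis (IZR k * theta x)) *
     (f t * cis (- (IZR k * theta t)) * RtoC (poisson a ta t)))%C).
  assert (HF : forall k t, F k t = (cis (IZR k * (P x - P t))
     * (RtoC (/ (2 * PI)) * (f t * RtoC (poisson a ta t))))%C).
  { intros k t; unfold F, P.
    rewrite Rmult_minus_distr_l; unfold Rminus at 1.
    rewrite cis_plus, !cis_opp, <- !(cis_IZR_mult_ext k _ _ (Hth _)); ring. }
  assert (Hsum : forall t, sum_sym n (fun k => F k t) =
    (dirichlet n (P x - P t)
     * (RtoC (/ (2 * PI)) * (f t * RtoC (poisson a ta t))))%C).
  { intros t; unfold dirichlet; rewrite sum_sym_mult_r.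
    apply sum_n_ext; intros j; apply HF. }
  apply (is_RInt_ext (V := C_R_NormedModule) (fun t => sum_sym n (fun k => F k t)));
    [intros t _; apply Hsum|].
  apply (is_RInt_sum_n (V := C_R_NormedModule)); intros j.
  set (k := (Z.of_nat j - Z.of_nat n)%Z).
  replace (nl_coef a ta theta f k * cis (IZR k * theta x))%C with
    (RtoC (/ (2 * PI)) * cis (IZR k * theta x) *
     RInt (V := C_R_CompleteNormedModule)
       (fun t : R => f t * cis (- (IZR k * theta t)) * RtoC (poisson a ta t))%C
       (- PI) PI)%C by (unfold nl_coef; ring).
  apply is_RInt_Cmult_l, (RInt_correct (V := C_R_CompleteNormedModule)).
  apply (ex_RInt_ext (V := C_R_NormedModule)
    (fun t => f t * cis (- (IZR k * P t)) * RtoC (poisson a ta t))%C).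
  { intros t _; unfold P; rewrite !cis_opp.
    now rewrite (cis_IZR_mult_ext k _ _ (Hth t)). }
  apply (ex_RInt_continuous (V := C_R_CompleteNormedModule)); intros t _.
  apply continuous_Cmult; [apply continuous_Cmult|].
  - apply Hf.
  - apply continuous_cis, (continuous_opp (V := R_NormedModule)),
      (continuous_mult (K := R_AbsRing)); [apply continuous_const|].
    apply (ex_derive_continuous P); eexists; now apply is_derive_phase.
  - now apply continuous_RtoC, continuous_poisson.
Qed.

(** The substitution s = phase(x) - phase(t), with ds = - p(t) dt, maps [-pi, pi]
    onto an interval of length 2 pi, over which |D_n| has the same integral
    as over [-pi, pi]. *)
Lemma is_RInt_dirichlet_phase (a : C) (ta : R) (n : nat) (x : R) : Cmod a < 1 ->
  is_RInt (fun t => Cmod (dirichlet n (phase (Cmod a) ta x - phase (Cmod a) ta t))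
                    * poisson a ta t)
    (- PI) PI (2 * PI * lebesgue_constant n).
Proof.
  intros Ha.
  set (P := phase (Cmod a) ta); set (G := fun s => Cmod (dirichlet n s)).
  assert (HG : forall s, continuous G s)
    by (intros s; apply continuous_Cmod, continuous_dirichlet).
  assert (HI : is_RInt (fun t => scal (- poisson a ta t) (G (P x - P t)))
                 (- PI) PI (RInt G (P x - P (- PI)) (P x - P PI))).
  { apply (is_RInt_comp (V := R_CompleteNormedModule) G (fun t => P x - P t)).
    - intros t _; apply HG.
    - intros t _; split.
      + replace (- poisson a ta t) with (minus 0 (poisson a ta t))
          by (unfold minus, plus, opp; simpl; ring).
        apply (is_derive_minus (fun _ => P x) P).
        * apply (is_derive_const (P x)).
        * now apply is_derive_phase.
      + now apply (continuous_opp (V := R_NormedModule)), continuous_poisson. }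
  apply (is_RInt_opp (V := R_NormedModule)) in HI.
  apply (is_RInt_ext _ (fun t => G (P x - P t) * poisson a ta t)) in HI.
  2: { intros t _; unfold scal, opp; simpl; unfold mult; simpl; ring. }
  assert (HL : 2 * PI * lebesgue_constant n = RInt G (- PI) PI)
    by (unfold lebesgue_constant; fold G; field; apply PI_neq0).
  assert (HPI : P PI = P (- PI) + 2 * PI).
  { unfold P; rewrite <- phase_2PI; f_equal; ring. }
  replace (2 * PI * lebesgue_constant n)
    with (opp (RInt G (P x - P (- PI)) (P x - P PI))); [exact HI|].
  rewrite (opp_RInt_swap (V := R_CompleteNormedModule)).
  2: { apply (ex_RInt_continuous (V := R_CompleteNormedModule)); intros; apply HG. }
  replace (P x - P (- PI)) with (P x - P PI + 2 * PI) by lra.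
  rewrite (RInt_period G (2 * PI) _ (- PI)); [|exact HG|].
  2: { intros t; unfold G; now rewrite dirichlet_2PI. }
  replace (- PI + 2 * PI) with PI by ring.
  exact (eq_sym HL).
Qed.

Lemma Cmod_nl_partial_sum_le (a : C) (ta : R) (theta : R -> R) (f : R -> C)
    (n : nat) (x M : R) :
  Cmod a < 1 -> (forall t, cis (theta t) = cis (phase (Cmod a) ta t)) ->
  (forall t, continuous f t) -> (forall t, Cmod (f t) <= M) ->
  Cmod (nl_partial_sum a ta theta n f x) <= lebesgue_constant n * M.
Proof.
  intros Ha Hth Hf HM.
  pose proof PI_RGT_0 as Hpi.
  rewrite <- norm_C_R.
  pose proof (is_RInt_scal _ _ _ (M / (2 * PI)) _ (is_RInt_dirichlet_phase a ta n x Ha)) as HI.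
  replace (lebesgue_constant n * M)
    with (M / (2 * PI) * (2 * PI * lebesgue_constant n)) by (field; lra).
  refine (norm_RInt_le (V := C_R_NormedModule) _ _ _ _ _ _ _ _
            (is_RInt_nl_partial_sum a ta theta f n x Ha Hth Hf) HI); [lra|].
  intros t _; rewrite norm_C_R, !Cmod_mult, !Cmod_R.
  pose proof (poisson_ge_0 a ta t Ha).
  rewrite (Rabs_pos_eq (poisson a ta t)) by assumption.
  rewrite (Rabs_pos_eq (/ (2 * PI))) by (apply Rlt_le, Rinv_0_lt_compat; lra).
  unfold scal; simpl; unfold mult; simpl.
  set (D := Cmod (dirichlet _ _)).
  assert (HD : 0 <= D) by apply Cmod_ge_0.
  replace (M / (2 * PI) * (D * poisson a ta t))
    with (D * (/ (2 * PI) * (M * poisson a ta t))) by (field; lra).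
  apply Rmult_le_compat_l; [assumption|].
  apply Rmult_le_compat_l; [apply Rlt_le, Rinv_0_lt_compat; lra|].
  now apply Rmult_le_compat_r.
Qed.

(** * Boundedness of continuous functions on the circle *)

Lemma periodic_IZR (f : R -> C) (T : R) :
  (forall t, f (t + T) = f t) -> forall (k : Z) t, f (t + IZR k * T) = f t.
Proof.
  intros HT.
  assert (Hnat : forall (m : nat) t, f (t + INR m * T) = f t).
  { induction m as [|m IH]; intros t.
    - f_equal; simpl; ring.
    - rewrite <- (IH t), <- (HT (t + INR m * T)); f_equal; rewrite S_INR; ring. }
  intros k t; destruct (Z_le_gt_dec 0 k) as [Hk|Hk].
  - rewrite <- (Z2Nat.id k Hk), <- INR_IZR_INZ; apply Hnat.
  - rewrite <- (Hnat (Z.to_nat (- k)) (t + IZR k * T)).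
    rewrite INR_IZR_INZ, Z2Nat.id, opp_IZR by lia; f_equal; ring.
Qed.

Lemma continuous_on_circle_bounded (f : R -> C) :
  continuous_on_circle f -> exists M, forall t, Cmod (f t) <= M.
Proof.
  intros [Hc HT]; pose proof PI_RGT_0 as Hpi.
  destruct (continuity_ab_maj (fun t => Cmod (f t)) 0 (2 * PI)) as [s [Hs _]].
  - lra.
  - intros t _; apply continuity_pt_filterlim, continuous_Cmod, Hc.
  - exists (Cmod (f s)); intros t.
    destruct (archimed (t / (2 * PI))) as [H1 H2].
    (* [up q] is the integer with q < up q <= q + 1, so q + k lies in [0, 1). *)
    set (k := (1 - up (t / (2 * PI)))%Z).
    rewrite <- (periodic_IZR f _ HT k t).
    assert (Ht : t = t / (2 * PI) * (2 * PI)) by (field; lra).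
    apply Hs; unfold k; rewrite minus_IZR.
    set (q := t / (2 * PI)) in *; nra.
Qed.

(** With a finite supremum, the product of a constant and the norm in the extended
    reals is an ordinary product; an infinite one would raise the case
    0 * p_infty = 0. *)
Lemma sup_norm_spec (f : R -> C) :
  continuous_on_circle f ->
  exists M, sup_norm f = Finite M /\ forall t, Cmod (f t) <= M.
Proof.
  intros Hf; destruct (continuous_on_circle_bounded f Hf) as [B HB].
  destruct (Lub_Rbar_correct (fun y : R => exists x : R, y = Cmod (f x))) as [Hub Hlub].
  fold (sup_norm f) in Hub, Hlub.
  assert (HleB : Rbar_le (sup_norm f) B) by (apply Hlub; intros y [x ->]; apply HB).
  assert (H : forall t, Rbar_le (Cmod (f t)) (sup_norm f))
    by (intros t; apply Hub; now exists t).
  destruct (sup_norm f) as [M| |].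
  - now exists M.
  - easy.
  - now specialize (H 0).
Qed.

Theorem theorem1 (a : C) (ta : R) (theta : R -> R)
    (ha : Cmod a < 1)
    (hta : a = (RtoC (Cmod a) * cis ta)%C)
    (htheta : is_nonlinear_phase a theta)
    (f : R -> C) (hf : continuous_on_circle f) (n : nat) :
  Rbar_le (sup_norm (nl_partial_sum a ta theta n f))
          (Rbar_mult (Finite (lebesgue_constant n)) (sup_norm f)).
Proof.
  destruct (sup_norm_spec f hf) as [M [-> HM]].
  destruct htheta as [_ Htheta], hf as [Hf _].
  assert (Hphase : forall t, cis (theta t) = cis (phase (Cmod a) ta t)).
  { intros t; rewrite Htheta, cis_phase by (split; [apply Cmod_ge_0 | exact ha]).
    now rewrite <- hta. }
  apply Lub_Rbar_correct; intros y [x ->]; simpl.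
  now apply Cmod_nl_partial_sum_le.
Qed.
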